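(* Let $g^{(r)}_k=\frac{1}{rk+1}\binom{(r+1)k}{k}$. For every integer $r\ge 2$ and all integers $m,n$ with $m+n\ge 0$, the set $\mathbb K(m,n,r)$ of all $K^{(r)}$-paths from $(-mr,-mr)$ to $(nr,nr)$ has cardinality $g^{(r)}_{n+m}$. For every integer $r\ge1$ and all integers $m,n,s$ with $m+n\ge0$, the set $\mathbb T(m,n,r,s)$ of all $KT^{(r)}$-paths from $(s-mr,s-mr)$ to $(nr+s,nr+s)$ also has cardinality $g^{(r)}_{n+m}$.
   Context: Paths are finite sequences of points (vertices) of $\mathbb Z^2$; steps are differences of consecutive vertices. An $H_r$-path has steps $(r,0),(0,1)$; a $V_r$-path has steps $(1,0),(0,r)$; a $T^{(r)}$-path has steps $(r-k,k)$ for $0\le k\le r$. A $K^{(r)}$-path ($r\ge2$) is a path $P$ such that: (1) $P$ never goes above the diagonal (all vertices satisfy $y\le x$); (2) the part of $P$ to the left of the line $y=-rx$ is a $V_r$-path; (3) the part of $P$ between the lines $y=-rx$ and $x=-ry$ is a $T^{(r-1)}$-path; (4) the part of $P$ above the line $x=-ry$ is an $H_r$-path. Some parts may be empty, and consecutive parts meet at a vertex on the separating line. Precisely, all vertices satisfy $y\le x$, and each step from a vertex $(x,y)$ satisfies: if $y<-rx$, the step is $(1,0)$ or $(0,r)$ and its endpoint $(x',y')$ has $y'\le -rx'$; if $y\ge -rx$ and $x<-ry$, the step is $(r-1-k,k)$ for some $0\le k\le r-1$ and its endpoint has $x'\le -ry'$; if $x\ge -ry$, the step is $(r,0)$ or $(0,1)$.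 A $KT^{(r)}$-path is a path $P$ such that: (1) $P$ never goes above the diagonal; (2) the part of $P$ to the left of the line $x=0$ is a $V_r$-path; (3) the part of $P$ in the fourth quadrant is a $T^{(r)}$-path; (4) the part of $P$ above the line $y=0$ is an $H_r$-path. Some parts may be empty, and consecutive parts meet at a vertex on the separating line. Precisely, all vertices satisfy $y\le x$, and each step from a vertex $(x,y)$ satisfies: if $x<0$, the step is $(1,0)$ or $(0,r)$; if $x\ge0$ and $y<0$, the step is $(r-k,k)$ for some $0\le k\le r$ and its endpoint has $y'\le 0$; if $x\ge0$ and $y\ge0$, the step is $(r,0)$ or $(0,1)$. *)

(* Defs.v *)
From mathcomp Require Import all_boot all_order all_algebra.
From mathcomp Require Import classical_sets functions cardinality.
Set Implicit Arguments.
Unset Strict Implicit.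
Unset Printing Implicit Defensive.
Import Order.TTheory GRing.Theory Num.Theory.
Local Open Scope ring_scope.

(* Truncated division is exact here: see dvdn_gnum. *)
Definition gnum (r k : nat) : nat := ('C(r.+1 * k, k) %/ (r * k).+1)%N.

Lemma dvdn_gnum (r k : nat) : ((r * k).+1 %| 'C(r.+1 * k, k))%N.
Proof.
case: k => [|k]; first by rewrite muln0.
have cop : coprime (r * k.+1).+1 k.+1.
  by rewrite -[(r * k.+1).+1]addn1 coprime_sym /coprime gcdnMDl gcdn1.
rewrite -(Gauss_dvdr _ cop) mul_bin_left.
have -> : (r.+1 * k.+1 - k = (r * k.+1).+1)%N.
  by rewrite mulSn addnC addnS subSn ?addnK // leq_addl.
exact: dvdn_mulr.
Qed.

Definition lattice_point : Type := (int * int)%type.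

(* d is a step, i.e. the difference of two consecutive vertices. *)
Definition Hstep (r : nat) (d : lattice_point) : bool :=
  (d == (r%:Z, 0)) || (d == (0, 1)).

Definition Vstep (r : nat) (d : lattice_point) : bool :=
  (d == (1, 0)) || (d == (0, r%:Z)).

Definition Tstep (r : nat) (d : lattice_point) : bool :=
  [exists k : 'I_r.+1, d == (r%:Z - k%:Z, k%:Z)].

Definition below_diag (P : lattice_point) : bool := P.2 <= P.1.

(* For r >= 2 and y <= x, the three hypotheses are mutually exclusive. *)
Definition Kstep (r : nat) : rel lattice_point := fun P Q =>
  let: (x, y) := P in let: (x', y') := Q in
  [&& (y < - r%:Z * x) ==> Vstep r (Q - P) && (y' <= - r%:Z * x'),
      (- r%:Z * x <= y) && (x < - r%:Z * y) ==>
        Tstep r.-1 (Q - P) && (x' <= - r%:Z * y')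
    & (- r%:Z * y <= x) ==> Hstep r (Q - P)].

Definition KTstep (r : nat) : rel lattice_point := fun P Q =>
  let: (x, y) := P in let: (x', y') := Q in
  [&& (x < 0) ==> Vstep r (Q - P),
      (0 <= x) && (y < 0) ==> Tstep r (Q - P) && (y' <= 0)
    & (0 <= x) && (0 <= y) ==> Hstep r (Q - P)].

(* A path is the sequence of its vertices; [goes_from] excludes the empty one. *)
Definition Kpath (r : nat) (p : seq lattice_point) : bool :=
  all below_diag p && sorted (Kstep r) p.

Definition KTpath (r : nat) (p : seq lattice_point) : bool :=
  all below_diag p && sorted (KTstep r) p.

Definition goes_from (A B : lattice_point) (p : seq lattice_point) : Prop :=
  ohead p = Some A /\ last A p = B.

Definition Kpaths (m n : int) (r : nat) : set (seq lattice_point) :=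
  [set p | Kpath r p /\
     goes_from (- m * r%:Z, - m * r%:Z) (n * r%:Z, n * r%:Z) p]%classic.

Definition KTpaths (m n : int) (r : nat) (s : int) : set (seq lattice_point) :=
  [set p | KTpath r p /\
     goes_from (s - m * r%:Z, s - m * r%:Z) (n * r%:Z + s, n * r%:Z + s) p]%classic.

(* Main.v *)
Require Import Defs.
From mathcomp Require Import all_boot all_order all_algebra zify ring.
From mathcomp Require Import classical_sets functions cardinality.
Set Implicit Arguments.
Unset Strict Implicit.
Unset Printing Implicit Defensive.
Import Order.TTheory GRing.Theory Num.Theory.
Local Open Scope ring_scope.
Local Open Scope classical_set_scope.
Local Open Scope card_scope.

(** Fix the two endpoints on the diagonal and let the zones move along it.  The
    number of paths does not change, and once the zones have moved down to the
    starting point the whole path runs in the last zone, where it is a walk with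
    steps [+r] and [-1] measured by the distance to the diagonal; those are
    counted by the Fuss-Catalan numbers ([npaths_raney], [raney_gnum]).

    To see the invariance, let f be the number of paths from a point to the fixed
    end, as a function of that point.  Write A and B for the shifts by (1,0) and
    (0,1).  In the three zones f is fixed by V = A + B^r, by the sum T of the
    A^(t-k) B^k, and by H = A^r + B, respectively.  The identities

      (A - B) (1 - T) = A (1 - A^r) - B (1 - B^r)   for t = r,
      (A - B) (1 - T) = V - H                       for t = r - 1,

    say that a step of the first zone taken before the middle zone can be traded
    for a step of the last zone taken after it, up to terms supported where the
    two separating lines meet, and those terms vanish because of the diagonal.
    Hence the counting function for the moved zones equals the old one on the
    first zone and its border ([KT_shift_middle] and [KT_shift_below] for
    KT-paths, [K_shift_middle] and [K_shift_below] for K-paths).  For KT-paths the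
    zones move by the diagonal vector (1,1).  For K-paths the elementary motion
    replaces both separating lines by the next parallels that the paths can stop
    on; their meeting point need not be a lattice point in between.  Motions
    before the start or after the end of the path are easier: there the whole
    path lies in the last zone ([KT_shift_above], [K_shift_above]), or in the
    first zone up to its end ([KT_shift_beyond], [K_shift_beyond]). *)

(** * Enumerating the walks that reach a target *)

Lemma card_uniq_seq (T : eqType) (s : seq T) :
  uniq s -> [set x | x \in s] #= `I_(size s).
Proof.
move=> us; apply/card_set_bijP; exists (index^~ s); split.
- by move=> x /= xs; rewrite index_mem.
- by move=> x y /set_mem xs /set_mem ys; exact: index_inj.
- case: s us => [|x0 s] us n //= ltn; exists (nth x0 (x0 :: s) n) => /=.
    exact: mem_nth.
  exact: (@index_uniq _ x0 n (x0 :: s) ltn us).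
Qed.

Section Walks.
Variables (T : eqType) (next : T -> seq T) (lev : T -> int) (B : T).

(** The fuel [n] bounds the number of vertices.  A walk may go on after meeting
    [B], so both contributions appear; when the moves are graded by [lev] no
    walk meets [B] twice. *)
Fixpoint walks (n : nat) (P : T) : seq (seq T) :=
  if n is n'.+1 then
    nseq (P == B) [:: P] ++ [seq P :: p | Q <- next P, p <- walks n' Q]
  else [::].

(** Each move raises [lev] by at least one, hence this fuel never runs out. *)
Definition nwalks (P : T) : nat := size (walks `|lev B - lev P|.+1 P).

Lemma size_walksS n P :
  size (walks n.+1 P) = ((P == B) + \sum_(Q <- next P) size (walks n Q))%N.
Proof.
by rewrite /= size_cat size_nseq size_allpairs_dep sumnE big_map.
Qed.

(** Along a walk to [B], a quantity that no move decreases stays below its value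
    at [B]. *)
Lemma size_walks_eq0 (phi : T -> int) n P :
    (forall P Q, Q \in next P -> phi P <= phi Q) -> phi B < phi P ->
  size (walks n P) = 0%N.
Proof.
move=> phi_mono; elim: n P => // n IHn P ltBP.
rewrite size_walksS; case: eqVneq ltBP => [->|_ ltBP]; first by rewrite ltxx.
rewrite big_seq big1 // => Q /phi_mono lePQ.
exact/IHn/(lt_le_trans ltBP).
Qed.

Lemma nwalks_eq0 (phi : T -> int) P :
    (forall P Q, Q \in next P -> phi P <= phi Q) -> phi B < phi P ->
  nwalks P = 0%N.
Proof. exact: size_walks_eq0. Qed.

Hypothesis next_lev : forall P Q, Q \in next P -> lev P < lev Q.

(** Fuel beyond [lev B - lev P] changes nothing.  The bounds are stated in [int]
    so that they also cover [lev B < lev P], where there is no walk at all. *)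
Lemma size_walks_fuel n n' P :
  lev B - lev P < n%:Z -> lev B - lev P < n'%:Z ->
  size (walks n P) = size (walks n' P).
Proof.
have none k Q : lev B < lev Q -> size (walks k Q) = 0%N.
  by apply: size_walks_eq0 => ? ? /next_lev/ltW.
elim: n n' P => [|n IHn] [|n'] P ltn ltn' //.
- by rewrite [RHS]none //; lia.
- by rewrite [LHS]none //; lia.
rewrite !size_walksS; congr (_ + _)%N; apply: eq_big_seq => Q /next_lev lPQ.
by apply: IHn; lia.
Qed.

Lemma nwalksE P : nwalks P = ((P == B) + \sum_(Q <- next P) nwalks Q)%N.
Proof.
rewrite /nwalks size_walksS; congr (_ + _)%N.
apply: eq_big_seq => Q /next_lev lPQ.
by apply: size_walks_fuel; lia.
Qed.

Lemma mem_walks n P p : lev B - lev P < n%:Z ->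
  (p \in walks n P) =
  [&& ohead p == Some P, sorted (fun P Q => Q \in next P) p & last P p == B].
Proof.
elim: n P p => [|n IHn] P p ltn.
  apply/esym/negP => /and3P[]; case: p => // _ p /eqP[->] /=.
  have lep : path (fun P Q => Q \in next P) P p -> lev P <= lev (last P p).
    elim: p P {ltn} => //= Q p IHp P /andP[/next_lev lPQ /IHp].
    exact/le_trans/ltW.
  by move=> /lep + /eqP eB; rewrite eB; lia.
rewrite /= mem_cat mem_nseq.
apply/orP/and3P => [[/andP[PB /eqP->]|]|[]].
- by rewrite lt0b in PB.
- case/allpairsPdep => Q [q [PQ + ->]].
  rewrite IHn; last by have := next_lev PQ; lia.
  by case: q => // _ q /and3P[/eqP[->] /= -> ->]; rewrite PQ.
case: p => // _ [|Q p] /eqP[->] /= => [_ PB|/andP[PQ pathp] lastp].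
  by left; rewrite lt0b PB eqxx.
right; apply/allpairsPdep; exists Q, (Q :: p); split => //.
rewrite IHn /= ?eqxx ?pathp //.
by have := next_lev PQ; lia.
Qed.

Lemma walks_uniq n P : (forall P, uniq (next P)) -> uniq (walks n P).
Proof.
move=> next_uniq; elim: n P => // n IHn P /=.
have headw m Q q : q \in walks m Q -> exists q', q = Q :: q'.
  case: m => //= m; rewrite mem_cat => /orP[|/allpairsPdep[? [q' [_ _ ->]]]].
    by rewrite mem_nseq => /andP[_ /eqP->]; exists [::].
  by exists q'.
rewrite cat_uniq; apply/and3P; split.
- by case: (P == B).
- apply/hasPn => _ /allpairsPdep[Q [q [_ + ->]]].
  case/headw => q' ->; rewrite mem_nseq; apply/negP => /andP[_].
  by rewrite eqseq_cons andbF.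
apply: allpairs_uniq_dep => // [[Q q] [Q' q']].
case/allpairsPdep=> ? [? [_ /headw[q1 ->] [-> ->]]].
case/allpairsPdep=> ? [? [_ /headw[q2 ->] [-> ->]]] /=.
by case=> -> ->.
Qed.

Lemma card_nwalks (A : T) : (forall P, uniq (next P)) ->
  [set p | [&& ohead p == Some A, sorted (fun P Q => Q \in next P) p
             & last A p == B]] #= `I_(nwalks A).
Proof.
move=> next_uniq.
have := card_uniq_seq (walks_uniq `|lev B - lev A|.+1 A next_uniq).
rewrite -/(nwalks A); move: (nwalks A) => k; congr (is_true (_ #= _)).
have fuel : lev B - lev A < `|lev B - lev A|.+1%:Z by lia.
by apply/seteqP; split=> p; rewrite /mkset mem_walks.
Qed.
End Walks.

(** A walk started in a set closed under the moves depends only on the moves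
    inside that set. *)
Lemma eq_nwalks_on (T : eqType) (next next' : T -> seq T) (lev : T -> int) (B : T)
    (S : T -> Prop) :
    (forall P, S P -> next P = next' P) ->
    (forall P Q, S P -> Q \in next P -> S Q) ->
  forall P, S P -> nwalks next lev B P = nwalks next' lev B P.
Proof.
move=> eq_next Snext P SP; rewrite /nwalks; move: _.+1 => n.
elim: n P SP => // n IHn P SP; rewrite !size_walksS -eq_next //.
by congr (_ + _)%N; apply: eq_big_seq => Q PQ; apply: IHn; apply: (Snext P).
Qed.

(** * Three-zone lattice paths below the diagonal *)

(** Both families of paths are instances: the zone of [P] is read off the signs
    of two affine forms [v] and [h], and a step out of a zone may reach but not
    cross the separating line.  The two families differ in the forms and in the
    length [t] of the middle steps.  Points above the diagonal have no moves:
    since the target lies on the diagonal they are dead ends, which enforces the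
    diagonal condition while keeping the recurrences free of tests on the
    endpoints. *)
Definition moves (r t : nat) (v h : lattice_point -> int) (P : lattice_point) :
    seq lattice_point :=
  let: (x, y) := P in
  if x < y then [::]
  else if v P < 0 then
    [seq Q <- [:: (x + 1, y); (x, y + r%:Z)] | v Q <= 0]
  else if h P < 0 then
    [seq Q <- [seq (x + (t%:Z - k%:Z), y + k%:Z) | k <- iota 0 t.+1] | h Q <= 0]
  else [:: (x + r%:Z, y); (x, y + 1)].

Section Moves.
Variables (r t : nat) (v h : lattice_point -> int).
Hypothesis r_gt0 : (0 < r)%N.
Variable b : int.

(** The slack [e] gives weak monotonicity for [e = 0] and strict monotonicity
    for [e = 1]. *)
Lemma moves_mono (phi : lattice_point -> int) (e : int) :
    (forall x y, phi (x, y) + e <= phi (x + 1, y)) ->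
    (forall x y, phi (x, y) + e <= phi (x, y + r%:Z)) ->
    (forall x y (k : nat), (k <= t)%N ->
       phi (x, y) + e <= phi (x + (t%:Z - k%:Z), y + k%:Z)) ->
    (forall x y, phi (x, y) + e <= phi (x + r%:Z, y)) ->
    (forall x y, phi (x, y) + e <= phi (x, y + 1)) ->
  forall P Q, Q \in moves r t v h P -> phi P + e <= phi Q.
Proof.
move=> p1 p2 p3 p4 p5 [x y] Q; rewrite /moves.
case: ifP => // _; case: ifP => _.
  by rewrite mem_filter !inE => /andP[_] /orP[]/eqP->.
case: ifP => _; last by rewrite !inE => /orP[]/eqP->.
rewrite mem_filter => /andP[_ /mapP[k]].
by rewrite mem_iota add0n ltnS => /p3 + ->.
Qed.

Lemma moves_uniq P : uniq (moves r t v h P).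
Proof.
case: P => x y; rewrite /moves.
case: ifP => // _; case: ifP => _.
  by apply: filter_uniq; rewrite /= !inE !xpair_eqE; lia.
case: ifP => _; last by rewrite /= !inE !xpair_eqE; lia.
apply/filter_uniq; rewrite map_inj_uniq ?iota_uniq // => k l [] _; lia.
Qed.

Hypothesis t_gt0 : (0 < t)%N.

Definition lev (P : lattice_point) : int := P.1 + P.2.

Lemma moves_lev P Q : Q \in moves r t v h P -> lev P < lev Q.
Proof.
move=> PQ; suff: lev P + 1 <= lev Q by lia.
by apply: moves_mono PQ => *; rewrite /lev /=; lia.
Qed.

(** Integer-valued, because the relations between counts involve
    differences. *)
Definition npaths (P : lattice_point) : int :=
  (nwalks (moves r t v h) lev (b, b) P)%:Z.

Local Notation N := npaths.

Lemma npathsE P : N P = (P == (b, b))%:Z + \sum_(Q <- moves r t v h P) N Q.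
Proof.
by rewrite /N (nwalksE _ moves_lev) PoszD (big_morph Posz PoszD (erefl _)).
Qed.

Lemma npaths_eq0 (phi : lattice_point -> int) P :
  (forall P Q, Q \in moves r t v h P -> phi P <= phi Q) ->
  phi (b, b) < phi P -> N P = 0.
Proof. by move=> ? ?; rewrite /N (@nwalks_eq0 _ _ _ _ phi). Qed.

Lemma npaths_above x y : x < y -> N (x, y) = 0.
Proof.
move=> ltxy; rewrite npathsE /moves ltxy big_nil xpair_eqE; lia.
Qed.

Lemma npaths_V x y : y <= x -> v (x, y) < 0 -> v (x + 1, y) <= 0 ->
    v (x, y + r%:Z) <= 0 ->
  N (x, y) = ((x, y) == (b, b))%:Z + N (x + 1, y) + N (x, y + r%:Z).
Proof.
move=> yx v0 v1 v2; rewrite npathsE /moves ltNge yx v0 /= v1 v2.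
by rewrite !big_cons big_nil addr0 addrA.
Qed.

Lemma npaths_T x y : y <= x -> 0 <= v (x, y) -> h (x, y) < 0 ->
  N (x, y) = ((x, y) == (b, b))%:Z +
   \sum_(k < t.+1) (if h (x + (t%:Z - k%:Z), y + k%:Z) <= 0
                    then N (x + (t%:Z - k%:Z), y + k%:Z) else 0).
Proof.
move=> yx v0 h0; rewrite npathsE /moves ltNge yx ltNge v0 h0; congr (_ + _).
rewrite big_filter big_map big_mkcond.
by rewrite -[iota 0 t.+1]/(index_iota 0 t.+1) big_mkord.
Qed.

Lemma npaths_H x y : y <= x -> 0 <= v (x, y) -> 0 <= h (x, y) ->
  N (x, y) = ((x, y) == (b, b))%:Z + N (x + r%:Z, y) + N (x, y + 1).
Proof.
move=> yx v0 h0; rewrite npathsE /moves !ltNge yx v0 h0 /=.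
by rewrite !big_cons big_nil addr0 addrA.
Qed.

End Moves.

(** * Two induction tools *)

Lemma shift_invariant (T : Type) (f : int -> T) :
  (forall c, f c = f (c + 1)) -> forall c c', f c = f c'.
Proof.
move=> step; have up c (n : nat) : f c = f (c + n%:Z).
  elim: n => [|n ->]; first by rewrite addr0.
  by rewrite step (_ : c + n%:Z + 1 = c + n.+1%:Z) //; lia.
move=> c c'; have [lecc'|/ltW lec'c] := leP c c'.
  by rewrite (up c `|c' - c|%N) (_ : c + _ = c') //; lia.
by rewrite (up c' `|c - c'|%N) (_ : c' + _ = c) //; lia.
Qed.

(** Induction from the target backwards: the recurrences express a count through
    counts at points where [phi] is larger, and everything is known from [M]
    on. *)
Lemma descending_ind (phi : lattice_point -> int) (M : int)
    (Pr : lattice_point -> Prop) :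
    (forall P, M <= phi P -> Pr P) ->
    (forall P, phi P < M -> (forall Q, phi P < phi Q -> Pr Q) -> Pr P) ->
  forall P, Pr P.
Proof.
move=> base step P; have [n] := ubnP `|M - phi P|%N.
elim: n P => // n IHn P ltn.
have [/base //|ltM] := lerP M (phi P).
apply: step => // Q ltPQ.
have [/base //|ltMQ] := lerP M (phi Q).
by apply: IHn; lia.
Qed.

(** * The zone of horizontal r-steps and unit vertical steps *)

(** The number of walks on the nonnegative integers from [d] to [0] with [a]
    steps [+r] and the necessary number of steps [-1], written as a difference
    of binomials: in this form Pascal's rule gives the recurrence at once, and
    the boundary value at [d = -1] vanishes. *)
Definition raney (r a d : nat) : int :=
  'C(r.+1 * a + d, a)%:Z -
  r%:Z * (if a is a'.+1 then 'C(r.+1 * a + d, a') else 0%N)%:Z.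

Lemma raney0 r d : raney r 0 d = 1.
Proof. by rewrite /raney bin0 mulr0 subr0. Qed.

(** The missing summand would be the value at [d = -1], and it is zero because
    [(a + 1) 'C(n, a + 1) = r (a + 1) 'C(n, a)] when [n - a = r (a + 1)]. *)
Lemma raneyS0 r a : raney r a.+1 0 = raney r a r.
Proof.
rewrite /raney addn0 (_ : r.+1 * a.+1 = (r.+1 * a + r).+1)%N; last by lia.
set n := (r.+1 * a + r)%N.
have /eqP : (a.+1 * 'C(n, a.+1) = a.+1 * (r * 'C(n, a)))%N.
  by rewrite mul_bin_left mulnA; congr (_ * _)%N; lia.
rewrite eqn_pmul2l // => /eqP eqC.
rewrite binS eqC; case: (a) => [|a']; first by rewrite !bin0; lia.
by rewrite binS; lia.
Qed.

Lemma raneySS r a d :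
  raney r a.+1 d.+1 = raney r a (d.+1 + r) + raney r a.+1 d.
Proof.
rewrite /raney (_ : r.+1 * a + (d.+1 + r) = r.+1 * a.+1 + d)%N; last by lia.
rewrite addnS; set n := (r.+1 * a.+1 + d)%N.
by rewrite binS; case: (a) => [|a']; rewrite ?bin0 ?(binS n); lia.
Qed.

Lemma raney_gnum r k : raney r k 0 = (gnum r k)%:Z.
Proof.
case: k => [|k]; first by rewrite raney0 /gnum !muln0 bin0.
rewrite /raney addn0; set n := (r.+1 * k.+1)%N.
have eqC : ('C(n, k.+1) = gnum r k.+1 * (r * k.+1).+1)%N.
  by rewrite /gnum divnK // dvdn_gnum.
have := mul_bin_left n k; rewrite eqC (_ : n - k = (r * k.+1).+1)%N; last first.
  by rewrite /n; lia.
rewrite mulnA mulnC => /eqP; rewrite eqn_pmul2l // => /eqP <-; lia.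
Qed.

Section PureH.
Variables (r t : nat) (v h : lattice_point -> int) (b : int).
Hypotheses (r_gt0 : (0 < r)%N) (t_gt0 : (0 < t)%N).
Hypothesis h_right : forall x y : int, h (x, y) <= h (x + r%:Z, y).
Hypothesis h_up : forall x y : int, h (x, y) <= h (x, y + 1).
Hypothesis v_ge0 : forall x y : int, y <= x -> 0 <= h (x, y) -> 0 <= v (x, y).
Local Notation N := (npaths r t v h b).

Lemma npaths_right x y : b < x -> N (x, y) = 0.
Proof.
move=> ltbx; apply: (npaths_eq0 (phi := fst)) => // P Q PQ.
by rewrite -[P.1]addr0; apply: moves_mono PQ => *; rewrite /=; lia.
Qed.

(** In the last zone the height [d] below the diagonal changes by [+r] or [-1],
    so the count satisfies the recurrence of [raney]. *)
Lemma npaths_raney (a d : nat) (x y : int) :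
    x = b - r%:Z * a%:Z -> y = x - d%:Z -> 0 <= h (x, y) ->
  N (x, y) = raney r a d.
Proof.
have step (x' y' : int) : y' <= x' -> 0 <= h (x', y') ->
    [/\ N (x', y') = ((x', y') == (b, b))%:Z + N (x' + r%:Z, y') + N (x', y' + 1),
        0 <= h (x' + r%:Z, y') & 0 <= h (x', y' + 1)].
  move=> yx' h0; split; [|exact: le_trans h0 _|exact: le_trans h0 _].
  by rewrite npaths_H // v_ge0.
elim: a d x y => [|a IHa] d x y ex.
  elim: d y => [|d IHd] y ey h0.
    have [|-> _ _] := step x y _ h0; first by lia.
    by rewrite npaths_right ?npaths_above ?raney0 ?xpair_eqE; lia.
  have [|-> _ h2] := step x y _ h0; first by lia.
  by rewrite npaths_right ?xpair_eqE ?IHd ?raney0 //; lia.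
elim: d y => [|d IHd] y ey h0.
  have [|-> h1 _] := step x y _ h0; first by lia.
  rewrite [N (x, y + 1)]npaths_above ?(IHa r) // ?xpair_eqE ?raneyS0; nia.
have [|-> h1 h2] := step x y _ h0; first by lia.
rewrite IHd ?(IHa (d.+1 + r)%N) // ?xpair_eqE ?raneySS; nia.
Qed.
End PureH.

Lemma npaths_lev r t v h b P : (0 < r)%N -> (0 < t)%N ->
  b + b < lev P -> npaths r t v h b P = 0.
Proof. by move=> r0 t0; apply: npaths_eq0 => ? ? /moves_lev/ltW; exact. Qed.

(** Counts inside the last zone do not depend on where the other zones are. *)
Lemma eq_npaths_H r t t' v h v' h' b (S : lattice_point -> Prop) :
    (forall x y, S (x, y) -> y <= x ->
       [&& 0 <= v (x, y), 0 <= h (x, y), 0 <= v' (x, y) & 0 <= h' (x, y)]) ->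
    (forall x y, S (x, y) -> S (x + r%:Z, y) /\ S (x, y + 1)) ->
  forall P, S P -> npaths r t v h b P = npaths r t' v' h' b P.
Proof.
move=> Szone Smove P SP; rewrite /npaths; congr (Posz _).
apply: (@eq_nwalks_on _ _ _ _ _ S) P SP => [[x y]|[x y] Q] SP.
  move/Szone: SP; rewrite /moves; case: ltP => // _ /(_ isT) /and4P[v0 h0 v0' h0'].
  by rewrite !ltNge v0 h0 v0' h0'.
have [S1 S2] := Smove _ _ SP; move/Szone: SP; rewrite /moves.
case: ltP => // _ /(_ isT) /and4P[v0 h0 _ _].
by rewrite !ltNge v0 h0 !inE => /orP[]/eqP->.
Qed.

(** * KT-paths: moving the origin along the diagonal *)

Section KT.
Variables (r : nat) (b : int).
Hypothesis r_gt0 : (0 < r)%N.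

(* The count when the three zones meet at [(c, c)] instead of the origin. *)
Local Notation N c := (npaths r r (fun P => P.1 - c) (fun P => P.2 - c) b).

Let far c P : b + b + 1 <= lev P -> N c P = 0.
Proof. by move=> ?; apply: npaths_lev => //; lia. Qed.

Lemma KT_shift_above c x y : c + 1 <= y -> N c (x, y) = N (c + 1) (x, y).
Proof.
move=> cy; apply: (@eq_npaths_H _ _ _ _ _ _ _ _ (fun P => c + 1 <= P.2)) => //=;
  by move=> {cy}x {}y /=; lia.
Qed.

Lemma KT_V c (x y : int) : x < c ->  y <= x ->
  N c (x, y) = ((x, y) == (b, b))%:Z + N c (x + 1, y) + N c (x, y + r%:Z).
Proof. by move=> xc yx; apply: npaths_V => //=; lia. Qed.

Section Shift.
Variable c : int.
Hypothesis ltcb : c < b.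

(** Extending the count by zero above the row [y = c] makes the middle
    recurrence hold without tests on the endpoints. *)
Definition cutKT (x y : int) : int := if y <= c then N c (x, y) else 0.

(** On the row [y = c] only the horizontal middle step stays in range, and it
    agrees with the horizontal step of the last zone; leaving that row upwards is
    the source term. *)
Lemma cutKT_rec (x y : int) : c <= x ->
  cutKT x y = \sum_(k < r.+1) cutKT (x + (r%:Z - k%:Z)) (y + k%:Z)
              + (if y == c then N c (x, c + 1) else 0).
Proof.
move=> cx; have [->|neyc] := eqVneq y c.
  rewrite big_ord_recl /= big1 ?addr0 ?subr0 => [|k _]; last first.
    by rewrite /cutKT /bump; case: ifP => //; lia.
  rewrite /cutKT lexx npaths_H //=; try lia.
  by rewrite xpair_eqE; lia.
rewrite addr0 {1}/cutKT; case: ifP => [leyc|/negP gtyc]; last first.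
  by rewrite big1 // => k _; rewrite /cutKT; case: ifP => //; lia.
rewrite npaths_T //=; try lia.
rewrite xpair_eqE (_ : _ && _ = false) ?add0r; last by lia.
by apply: eq_bigr => k _; rewrite /cutKT subr_le0.
Qed.

(** Let A and B be the shifts of functions by [(1, 0)] and [(0, 1)], and let T be
    the sum of the A^(r-k) B^k.  Then

      (A - B) (1 - T) = A (1 - A^r) - B (1 - B^r).

    Both counts are fixed by T in the middle zone, and the identity turns the
    horizontal steps on the row [y = c], encoded by [1 - A^r], into the vertical
    steps on the column [x = c], encoded by [1 - B^r].  In the proof, both sides satisfy the middle
    recurrence up to source terms near the row [y = c], and these telescope. *)
Lemma KT_shift_middle (x y : int) : c <= x -> y <= c ->
  cutKT x y - cutKT x (y + r%:Z) =
  N (c + 1) (x + 1, y) + (if y == c then N c (x, c + 1) else 0).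
Proof.
suff: forall P, c <= P.1 -> P.2 <= c ->
  cutKT P.1 P.2 - cutKT P.1 (P.2 + r%:Z) =
  N (c + 1) (P.1 + 1, P.2) + (if P.2 == c then N c (P.1, c + 1) else 0).
  by move=> /(_ (x, y)).
apply: (@descending_ind lev (b + b + 1)) => [] [{}x {}y] /=.
  move=> ltB cx yc; rewrite /cutKT !far; try by move: ltB; rewrite /lev /=; lia.
  by rewrite !if_same.
move=> _ IH cx yc.
(* [u k] is the source term carried by the middle step number [k - 1]. *)
pose u k : int := if y + k - 1 == c then N c (x + (r%:Z - k + 1), c + 1) else 0.
have uP : \sum_(k < r.+1) (u k.+1%:Z - u k%:Z) =
          if y + r%:Z == c then N c (x, c + 1) else 0.
  rewrite -(big_mkord xpredT (fun k : nat => u k.+1%:Z - u k%:Z)).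
  rewrite (telescope_sumr (fun k : nat => u k%:Z)) // /u.
  rewrite [in RHS](_ : (_ == c) = (y + r.+1%:Z - 1 == c)); last by lia.
  rewrite (_ : (y + 0 - 1 == c) = false) ?subr0; last by lia.
  by rewrite (_ : x + (_ - _ + 1) = x) //; lia.
rewrite (cutKT_rec y cx) (cutKT_rec (y + r%:Z) cx) -uP opprD addrACA -!sumrB.
rewrite addrC addrAC -addrA addrC; congr (_ + _).
rewrite npaths_T //=; try lia.
rewrite xpair_eqE (_ : (_ && _) = false) ?add0r -?sumrB; last by lia.
apply: eq_bigr => -[k /= ltkr] _.
rewrite (_ : y + r%:Z + k%:Z = y + k%:Z + r%:Z); last by ring.
rewrite (_ : x + 1 + (r%:Z - k%:Z) = x + (r%:Z - k%:Z) + 1); last by ring.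
have -> : u k.+1%:Z = if y + k%:Z == c then N c (x + (r%:Z - k%:Z), c + 1) else 0.
  rewrite /u (_ : y + k.+1%:Z - 1 = y + k%:Z); last by lia.
  by rewrite (_ : r%:Z - k.+1%:Z + 1 = r%:Z - k%:Z); last by lia.
(* The three cases: within the row [y = c], beyond the row [y = c + 1], on it. *)
have [leykc|ltcyk|eyk] := ltgtP (y + k%:Z) (c + 1).
- have -> := IH (x + (r%:Z - k%:Z), y + k%:Z); rewrite ?/lev /=; try lia.
  rewrite /u; do 3 (case: ifP => ?); lia.
- rewrite /cutKT /u; do 5 (case: ifP => ?); lia.
rewrite /cutKT /u eyk; rewrite -KT_shift_above // -[x + _ + 1]addrA.
by do 5 (case: ifP => ?); try lia; rewrite subr0 !sub0r opprK.
Qed.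

(** On the column [x = c] the relation of [KT_shift_middle] is exactly the
    recurrence of the first zone for the origin [c + 1]: the source term sits at
    [(c, c + 1)], above the diagonal.  Further left both counts obey that
    recurrence. *)
Lemma KT_shift_below (x y : int) : x <= c -> N c (x, y) = N (c + 1) (x, y).
Proof.
suff: forall P, P.1 <= c -> N c P = N (c + 1) P by move=> /(_ (x, y)).
apply: (@descending_ind lev (b + b + 1)) => [] [{}x {}y] /=.
  by move=> ltB xc; rewrite !far.
move=> _ IH xc; have [ltxy|leyx] := ltP x y; first by rewrite !npaths_above.
have [ltxc|lecx] := ltP x c.
  rewrite (KT_V ltxc leyx) (@KT_V (c + 1)) //; last by lia.
  by rewrite (IH (x + 1, y)) ?(IH (x, y + r%:Z)) /lev //=; lia.
have ex : x = c by lia.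
have yc : y <= c by lia.
have := KT_shift_middle lecx yc.
rewrite (@KT_V (c + 1) x) //; last by lia.
rewrite xpair_eqE [N c (x, c + 1)]npaths_above ?if_same //; last by lia.
rewrite /cutKT yc; case: ifP => ltyr.
  by rewrite (IH (x, y + r%:Z)) /lev //=; lia.
by rewrite [N _ (x, y + _)]npaths_above; lia.
Qed.
End Shift.

(** With the origin at or beyond the target only first-zone moves matter.  When
    [c = b], the column [x = b] belongs to the middle zone, but there the only
    middle step that does not pass to the right of the target is [(0, r)]. *)
Lemma KT_shift_beyond (c x y : int) :
  b <= c -> x <= b -> N c (x, y) = N (c + 1) (x, y).
Proof.
move=> lebc; suff: forall P, P.1 <= b -> N c P = N (c + 1) P by move=> /(_ (x, y)).
have right c' x' y' : b < x' -> N c' (x', y') = 0 by exact: npaths_right.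
apply: (@descending_ind lev (b + b + 1)) => [] [{}x {}y] /=.
  by move=> ltB xb; rewrite !far.
move=> _ IH xb; have [ltxy|leyx] := ltP x y; first by rewrite !npaths_above.
have IHr : N c (x + 1, y) = N (c + 1) (x + 1, y).
  have [lexb|ltbx] := leP (x + 1) b; last by rewrite !right.
  by apply: IH => //=; rewrite /lev /=; lia.
have IHu : N c (x, y + r%:Z) = N (c + 1) (x, y + r%:Z).
  by apply: IH => //=; rewrite /lev /=; lia.
have [lecx|ltxc] := leP c x; last first.
  by rewrite (KT_V ltxc leyx) (@KT_V (c + 1)) ?IHr ?IHu //; lia.
have {lecx} [ex ec] : x = b /\ c = b by lia.
rewrite [RHS]KT_V -?IHr -?IHu //; last by lia.
rewrite (right c (x + 1)) ?addr0; last by lia.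
have [ltyb|leby] := ltP y b; last first.
  rewrite npaths_H //=; try lia.
  by rewrite (right c (x + r%:Z)) ?npaths_above ?addr0 //; lia.
rewrite npaths_T //=; try lia.
congr (_ + _); rewrite big_ord_recr big1 ?add0r /= => [|k _]; last first.
  by rewrite right ?if_same //; have := ltn_ord k; lia.
rewrite subrr addr0; case: ifP => // ?.
by rewrite npaths_above //; lia.
Qed.

Lemma KT_origin (c c' a : int) : a <= b -> N c (a, a) = N c' (a, a).
Proof.
move=> leab; have step d : N d (a, a) = N (d + 1) (a, a).
  have [lead|ltda] := leP a d; last by apply: KT_shift_above; lia.
  have [ltdb|lebd] := ltP d b; first exact: KT_shift_below.
  exact: KT_shift_beyond.
exact: (shift_invariant (f := fun d => N d (a, a))).
Qed.

(** With the origin moved to the starting point, the path stays in the last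
    zone. *)
Lemma KT_count (c : int) (n : nat) :
  N c (b - r%:Z * n%:Z, b - r%:Z * n%:Z) = (gnum r n)%:Z.
Proof.
set a := b - _; rewrite (KT_origin c a) ?/a; last by nia.
rewrite -raney_gnum; apply: npaths_raney => //=; rewrite -/a; lia.
Qed.

End KT.

(** * From paths to walks *)

Lemma pair_subE (x y x' y' : int) : (x', y') - (x, y) = (x' - x, y' - y).
Proof. by []. Qed.

Lemma Tstep_mem (t : nat) (x y x' y' : int) :
  Tstep t ((x', y') - (x, y)) =
  ((x', y') \in [seq (x + (t%:Z - k%:Z), y + k%:Z) | k <- iota 0 t.+1]).
Proof.
rewrite pair_subE; apply/existsP/mapP => [[k /eqP[ex ey]]|[k + [ex ey]]].
  exists (nat_of_ord k); first by rewrite mem_iota ltn_ord.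
  by congr (_, _); lia.
rewrite mem_iota => /= kt; exists (inord k); rewrite inordK // xpair_eqE.
by lia.
Qed.

Lemma Vstep_mem (r : nat) (x y x' y' : int) :
  Vstep r ((x', y') - (x, y)) = ((x', y') \in [:: (x + 1, y); (x, y + r%:Z)]).
Proof. by rewrite /Vstep pair_subE !inE !xpair_eqE; lia. Qed.

Lemma Hstep_mem (r : nat) (x y x' y' : int) :
  Hstep r ((x', y') - (x, y)) = ((x', y') \in [:: (x + r%:Z, y); (x, y + 1)]).
Proof. by rewrite /Hstep pair_subE !inE !xpair_eqE; lia. Qed.

(* Keeps the filtered lists of [moves] recognizable to [mem_filter]. *)
Local Arguments filter : simpl never.
Local Arguments map : simpl never.
Local Arguments iota : simpl never.

Lemma KTstep_moves (r : nat) (P Q : lattice_point) :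
  (Q \in moves r r (fun P => P.1 - 0) (fun P => P.2 - 0) P) =
  below_diag P && KTstep r P Q.
Proof.
case: P Q => x y [x' y']; rewrite /below_diag /KTstep /moves /=.
rewrite !subr0; case: (ltP x y) => //= yx.
case: (ltP x 0) => /= x0.
  rewrite mem_filter -Vstep_mem /= subr0 andbT andbC.
  by rewrite /Vstep pair_subE !xpair_eqE; lia.
case: (ltP y 0) => /= y0.
  by rewrite mem_filter -Tstep_mem /= subr0 andbT andbC.
by rewrite -Hstep_mem.
Qed.

(** Below the diagonal [- r y <= x] implies [- r x <= y], so testing the zones one
    after the other agrees with the three separate implications. *)
Lemma Kstep_moves (r : nat) (P Q : lattice_point) : (2 <= r)%N ->
  (Q \in moves r r.-1 (fun P => P.2 + r%:Z * P.1 - 0 * r%:Z)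
           (fun P => P.1 + r%:Z * P.2 - 0 * r%:Z) P) =
  below_diag P && Kstep r P Q.
Proof.
move=> r2; case: P Q => x y [x' y']; rewrite /below_diag /Kstep /moves /=.
rewrite !mul0r; case: (ltP x y) => //= yx.
rewrite !subr0 (_ : (y + r%:Z * x < 0) = (y < - r%:Z * x)); last by lia.
rewrite (_ : (x + r%:Z * y < 0) = (x < - r%:Z * y)); last by lia.
case: (ltP y (- r%:Z * x)) => /= v0.
  rewrite (_ : (_ <= x) = false); last by nia.
  rewrite mem_filter -Vstep_mem /= subr0 andbT andbC; congr (_ && _).
  lia.
case: (ltP x (- r%:Z * y)) => /= h0.
  by rewrite mem_filter -Tstep_mem /= subr0 andbT andbC; congr (_ && _); lia.
by rewrite -Hstep_mem.
Qed.

(** All vertices but the last have a move, hence lie below the diagonal; the last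
    one does by hypothesis. *)
Lemma path_moves (step : rel lattice_point)
    (next : lattice_point -> seq lattice_point) (P : lattice_point)
    (p : seq lattice_point) :
    (forall P Q, (Q \in next P) = below_diag P && step P Q) ->
    below_diag (last P p) ->
  path (fun P Q => Q \in next P) P p = all below_diag (P :: p) && path step P p.
Proof.
move=> nextE; elim: p P => [|Q p IHp] P /= lastB; first by rewrite lastB.
by rewrite IHp // nextE /=; case: (below_diag P); case: (step P Q); rewrite ?andbF.
Qed.

Lemma card_paths (r t : nat) (v h : lattice_point -> int) (step : rel lattice_point)
    (a b : int) (k : nat) : (0 < r)%N -> (0 < t)%N ->
    (forall P Q, (Q \in moves r t v h P) = below_diag P && step P Q) ->
    npaths r t v h b (a, a) = k%:Z ->
  [set p | all below_diag p && sorted step p /\ goes_from (a, a) (b, b) p]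
    #= `I_k.
Proof.
move=> r0 t0 movesE [<-]; have moves_up := @moves_lev r t v h r0 t0.
have moves_u := @moves_uniq r t v h r0.
have := card_nwalks (b, b) moves_up (a, a) moves_u.
congr (is_true (_ #= _)); apply/seteqP; split=> -[|P p] /=; rewrite /goes_from //=.
- case/and3P=> /eqP[->] pathp /eqP lastp; split; last by rewrite lastp.
  by rewrite -(path_moves movesE) // lastp /below_diag /=.
- by case=> _ [].
- case=> pathp [[eP] lastp]; rewrite eP in pathp lastp *; rewrite lastp !eqxx andbT.
  by rewrite (path_moves movesE) // lastp /below_diag /=.
Qed.

(** * K-paths: moving the separating lines along the lattice *)

Lemma npaths_top r t v h b (phi : lattice_point -> int) P :
    (0 < r)%N -> (0 < t)%N ->
    (forall P Q, Q \in moves r t v h P -> phi P < phi Q) ->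
    phi (b, b) <= phi P ->
  npaths r t v h b P = (P == (b, b))%:Z.
Proof.
move=> r0 t0 up leP; rewrite npathsE // big_seq big1 ?addr0 // => Q /up ltPQ.
apply: (npaths_eq0 (phi := phi)); last exact: le_lt_trans ltPQ.
by move=> ? ? /up/ltW.
Qed.

Section K.
Variables (t : nat) (n : int).
Hypothesis t_gt0 : (0 < t)%N.

(* Writing r as [t.+1] makes r - 1, the length of the middle steps, a variable. *)
Local Notation r := (t.+1).
Local Notation b := (n * r%:Z).
(* The separating lines are [y + r x = j r] and [x + r y = j r], which meet at the
   diagonal point of abscissa [j r / (r + 1)]: moving the origin by [(r, r)] is
   moving [j] by [r + 1], and this is done one unit at a time. *)
Local Notation N j := (npaths r t (fun P => P.2 + r%:Z * P.1 - j * r%:Z)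
                                  (fun P => P.1 + r%:Z * P.2 - j * r%:Z) b).

Lemma K_shift_above (j x y : int) :
  (j + 1) * r%:Z <= x + r%:Z * y -> N j (x, y) = N (j + 1) (x, y).
Proof.
pose S P := (j + 1) * r%:Z <= P.1 + r%:Z * P.2.
by move=> Sxy; apply: (@eq_npaths_H _ _ _ _ _ _ _ _ S) => //= {Sxy}x {}y;
  rewrite /S /=; nia.
Qed.

(** Only ordinates divisible by r are considered: there every first-zone step
    raises [y + r x] by exactly r, so the separating line is never jumped. *)
Lemma K_V (j x z : int) : x + z < j -> r%:Z * z <= x ->
  N j (x, r%:Z * z) = ((x, r%:Z * z) == (b, b))%:Z
     + N j (x + 1, r%:Z * z) + N j (x, r%:Z * (z + 1)).
Proof.
move=> ltj yx; rewrite mulrDr mulr1.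
by apply: npaths_V => //=; nia.
Qed.

(** Extension by zero beyond the second separating line, and the restriction to
    that line, which acts as a source for the middle recurrence. *)
Definition cutK (j x y : int) : int :=
  if x + r%:Z * y <= j * r%:Z then N j (x, y) else 0.

Definition edgeK (j x y : int) : int :=
  if x + r%:Z * y == j * r%:Z then N j (x, y) else 0.

Lemma cutK_rec (j x y : int) : j <= n * r%:Z + n -> j * r%:Z <= y + r%:Z * x ->
  cutK j x y =
  \sum_(k < r) cutK j (x + (t%:Z - k%:Z)) (y + k%:Z) + edgeK j x y.
Proof.
move=> jn vxy.
have [ltxy|lexy] := ltP (x + r%:Z * y) (j * r%:Z); last first.
  rewrite big1 ?add0r => [|k _].
    by rewrite /cutK /edgeK; case: ifP; case: ifP => // ?; lia.
  have := ltn_ord k; rewrite /cutK => ltkr.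
  by case: ifP => //; nia.
rewrite [edgeK _ _ _](_ : _ = 0) ?addr0 /cutK; last first.
  by rewrite /edgeK; case: ifP => //; lia.
rewrite ltW // npaths_T //=; try nia.
rewrite xpair_eqE (_ : (_ && _) = false) ?add0r; last by nia.
by apply: eq_bigr => k _; rewrite subr_le0.
Qed.

Section Shift.
Variable j : int.
Hypothesis ltjn : j + 1 <= n * r%:Z + n.

(** Let A and B be the shifts of functions by [(1, 0)] and [(0, 1)], let
    V = A + B^r and H = A^r + B be the first-zone and last-zone operators, and let
    T be the sum of the A^(r-1-k) B^k.  Then

      V - H = (A - B) (1 - T),

    so taking one V-step before the middle zone or one H-step after it makes a
    difference located on the line [x + r y = (j + 1) r] only. *)
Lemma K_shift_middle (x y : int) : j * r%:Z <= y + r%:Z * x ->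
  cutK (j + 1) (x + 1) y + cutK (j + 1) x (y + r%:Z) =
  cutK j x y + edgeK (j + 1) (x + 1) y - edgeK (j + 1) x (y + 1).
Proof.
suff: forall P, j * r%:Z <= P.2 + r%:Z * P.1 ->
  cutK (j + 1) (P.1 + 1) P.2 + cutK (j + 1) P.1 (P.2 + r%:Z) =
  cutK j P.1 P.2 + edgeK (j + 1) (P.1 + 1) P.2 - edgeK (j + 1) P.1 (P.2 + 1).
  by move=> /(_ (x, y)).
have ltj1 : j <= n * r%:Z + n by lia.
have edge0 x' y' : x' + r%:Z * y' != (j + 1) * r%:Z -> edgeK (j + 1) x' y' = 0.
  by rewrite /edgeK => /negbTE->.
have cut0 i x' y' : i * r%:Z < x' + r%:Z * y' -> cutK i x' y' = 0.
  by rewrite /cutK leNgt => ->.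
apply: (@descending_ind (fun P => P.1 + r%:Z * P.2) (j * r%:Z + 1)) => [] [{}x {}y] /=.
  move=> phi vxy.
  rewrite (cut0 _ x) ?(cut0 j) ?(edge0 x (y + 1)) ?subr0 ?add0r; try nia.
  rewrite cutK_rec ?big1 ?add0r ?addr0 //; try nia.
  by move=> k _; apply: cut0; have := ltn_ord k; nia.
move=> lephi IH vxy.
rewrite (edge0 (x + 1)) ?addr0; last by nia.
(* On the line [x + r y = j r] the old count takes one step of the last zone. *)
have [ltphi|gephi] := ltP (x + r%:Z * y) (j * r%:Z); last first.
  have ephi : x + r%:Z * y = j * r%:Z by lia.
  rewrite (cut0 _ x) ?addr0; last by nia.
  rewrite cutK_rec; try nia.
  rewrite big_ord_recl big1 ?addr0 => [|k _]; last first.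
    by apply: cut0; rewrite /= /bump /=; nia.
  rewrite (edge0 (x + 1)) ?addr0 /=; last by nia.
  rewrite /cutK ephi lexx (_ : x + 1 + t%:Z = x + r%:Z); last by lia.
  rewrite (_ : (_ <= _) = true); last by nia.
  rewrite (@npaths_H _ _ _ _ _ _ _ x y) //=; try nia.
  rewrite xpair_eqE (_ : (_ && _) = false) ?add0r; last by nia.
  rewrite /edgeK (_ : (_ == _) = true); last by nia.
  rewrite !(@K_shift_above j); try nia.
  by rewrite addrK.
rewrite (edge0 x (y + 1)) ?subr0; last by nia.
rewrite (cutK_rec (j := j)) ?(@cutK_rec (j + 1) (x + 1)) //; try nia.
rewrite ?(@cutK_rec (j + 1) x) //; try nia.
rewrite (edge0 (x + 1)) ?addr0; last by nia.
rewrite [edgeK j x y](_ : _ = 0) ?addr0; last first.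
  by rewrite /edgeK; case: ifP => //; lia.
(* The boundary terms of the induction hypothesis telescope along the steps. *)
pose u (k : nat) := edgeK (j + 1) (x + r%:Z - k%:Z) (y + k%:Z).
have eu : \sum_(k < r) (u k.+1 - u k) = edgeK (j + 1) x (y + r%:Z).
  rewrite -(big_mkord xpredT (fun k => u k.+1 - u k)) telescope_sumr // /u.
  rewrite [edgeK _ (_ - 0%Z) _]edge0 ?subr0; last by nia.
  by rewrite addrK.
rewrite -eu addrA -big_split -big_split; apply: eq_bigr => -[k /= ltkr] _.
have := IH (x + (t%:Z - k%:Z), y + k%:Z).
rewrite /= /u.
rewrite (_ : x + (t%:Z - k%:Z) + 1 = x + r%:Z - k%:Z); last by lia.
rewrite (_ : x + 1 + (t%:Z - k%:Z) = x + r%:Z - k%:Z); last by lia.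
rewrite (_ : x + r%:Z - k.+1%:Z = x + (t%:Z - k%:Z)); last by lia.
rewrite (_ : y + k.+1%:Z = y + k%:Z + 1); last by lia.
rewrite (_ : y + r%:Z + k%:Z = y + k%:Z + r%:Z); last by lia.
by move=> ->; [ring | nia | nia].
Qed.

(** On the line [y + r x = j r], below the diagonal, both boundary terms of
    [K_shift_middle] vanish: one would need [y = x + 1], the other sits just above
    the diagonal.  What is left is the first-zone recurrence of the count for
    [j + 1].  The ordinate is [r z], so the induction runs on [x + z]. *)
Lemma K_shift_below (x z : int) : x + z <= j ->
  N j (x, r%:Z * z) = N (j + 1) (x, r%:Z * z).
Proof.
suff: forall P, P.1 + P.2 <= j ->
  N j (P.1, r%:Z * P.2) = N (j + 1) (P.1, r%:Z * P.2) by move=> /(_ (x, z)).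
apply: (@descending_ind (fun P => P.1 + P.2) j) => [] [{}x {}z] /=.
  move=> gej lej; have {gej lej} ej : x + z = j by lia.
  have [ltxz|lexz] := ltP x (r%:Z * z); first by rewrite !npaths_above.
  have vxz : j * r%:Z <= r%:Z * z + r%:Z * x by nia.
  have := K_shift_middle vxz.
  have yE : r%:Z * (z + 1) = r%:Z * z + r%:Z by lia.
  rewrite (@K_V (j + 1)) //; last by lia.
  rewrite xpair_eqE (_ : (_ && _) = false) ?add0r; last by nia.
  rewrite {2}/edgeK {1}/edgeK /cutK.
  rewrite (_ : (_ <= _) = true); last by nia.
  rewrite (_ : (x + r%:Z * (r%:Z * z) <= _) = true); last by nia.
  rewrite (_ : (x + 1 + _ == _) = false) ?addr0; last by nia.
  rewrite (_ : (if _ == _ then _ else _) = 0) ?subr0; last first.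
    by case: ifP => // ?; apply: npaths_above => //; nia.
  move=> <-; rewrite yE; congr (_ + _); case: ifP => // ?.
  by apply/esym/npaths_above => //; nia.
move=> ltj IH lej; have [ltxz|lexz] := ltP x (r%:Z * z).
  by rewrite !npaths_above.
have IHr := IH (x + 1, z); have IHu := IH (x, z + 1).
rewrite /= in IHr IHu.
have ltj1 : x + z < j + 1 by lia.
have ltj0 : x + z < j by lia.
rewrite (K_V ltj0 lexz) (K_V ltj1 lexz).
by rewrite IHr ?IHu //; lia.
Qed.
End Shift.

(** If the target is not beyond the first separating line, all relevant moves
    are first-zone moves up to the parallel to that line through the target,
    where the count is the indicator of the target. *)
Lemma K_shift_beyond (j x z : int) : n * r%:Z + n <= j -> x + z <= n * r%:Z + n ->
  N j (x, r%:Z * z) = N (j + 1) (x, r%:Z * z).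
Proof.
move=> len; suff: forall P, P.1 + P.2 <= n * r%:Z + n ->
  N j (P.1, r%:Z * P.2) = N (j + 1) (P.1, r%:Z * P.2) by move=> /(_ (x, z)).
apply: (@descending_ind (fun P => P.1 + P.2) (n * r%:Z + n)) => [] [{}x {}z] /=.
  move=> gen _; have top i : N i (x, r%:Z * z) = ((x, r%:Z * z) == (b, b))%:Z.
    apply: (@npaths_top _ _ _ _ _ (fun P => P.2 + r%:Z * P.1)) => //=; last by nia.
    move=> P Q PQ; suff : (P.2 + r%:Z * P.1) + 1 <= Q.2 + r%:Z * Q.1 by lia.
    apply: (@moves_mono _ _ _ _ (fun P => P.2 + r%:Z * P.1)) PQ => /= *; nia.
  by rewrite !top.
move=> ltn IH len'; have [ltxz|lexz] := ltP x (r%:Z * z).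
  by rewrite !npaths_above.
have IHr := IH (x + 1, z); have IHu := IH (x, z + 1).
rewrite /= in IHr IHu.
have ltj1 : x + z < j + 1 by lia.
have ltj0 : x + z < j by lia.
rewrite (K_V ltj0 lexz) (K_V ltj1 lexz).
by rewrite IHr ?IHu //; lia.
Qed.

Lemma K_origin (i j m : int) : m <= n ->
  N i (m * r%:Z, r%:Z * m) = N j (m * r%:Z, r%:Z * m).
Proof.
move=> lemn; set A := (_, _).
have step k : N k A = N (k + 1) A.
  have [lek|ltk] := leP (m * r%:Z + m) k; last by apply: K_shift_above; nia.
  have [ltkn|lenk] := ltP k (n * r%:Z + n); last by apply: K_shift_beyond; nia.
  by apply: K_shift_below; lia.
exact: (shift_invariant (f := fun k => N k A)).
Qed.

(** For [j] chosen so that the second separating line passes through the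
    starting point, the path stays in the last zone. *)
Lemma K_count (j : int) (k : nat) :
  N j ((n - k%:Z) * r%:Z, (n - k%:Z) * r%:Z) = (gnum r k)%:Z.
Proof.
rewrite [X in (_, X)]mulrC (K_origin j ((n - k%:Z) * r%:Z + (n - k%:Z))); last by lia.
by rewrite -raney_gnum; apply: npaths_raney => //=; nia.
Qed.

End K.

(** * The two cardinalities *)

Theorem theorem8p4 :
  (forall (r : nat) (m n : int), (2 <= r)%N -> 0 <= m + n ->
     Kpaths m n r #= `I_(gnum r `|(n + m)%R|%N)) /\
  (forall (r : nat) (m n s : int), (1 <= r)%N -> 0 <= m + n ->
     KTpaths m n r s #= `I_(gnum r `|(n + m)%R|%N)).
Proof.
split=> [r m n r2 mn|r m n s r1 mn].
  case: r r2 => [//|t] t1.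
  apply: (@card_paths t.+1 t _ _ _ _ _ _ _ _ (fun P Q => Kstep_moves P Q t1)) => //.
  rewrite -(K_count n t1 0) (_ : - m = n - `|(n + m)%R|%N%:Z) //; lia.
apply: (@card_paths r r _ _ _ _ _ _ _ _ (@KTstep_moves r)) => //.
rewrite -(KT_count (n * r%:Z + s) r1 0).
rewrite (_ : s - m * r%:Z = n * r%:Z + s - r%:Z * `|(n + m)%R|%N%:Z) //.
by rewrite gez0_abs; lia.
Qed.
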